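(* Let $g=\sum_{u=1}^4g_u\rho(u)+g_{\mathfrak X}\chi(\mathfrak X)\in C(\mathbb{KP})$ with complex coefficients satisfying $$g_1=1,\quad 1+g_2+g_3+g_4\pm2g_{\mathfrak X}\ge0,\quad 1+g_2-g_3-g_4\ge0,\quad 1-g_2+g_3-g_4\ge0,\quad 1-g_2-g_3+g_4\ge0$$ (each inequality meaning in particular that the left-hand side is real). Then the random walk $(\mathcal F(g)^{\star k})_{k}$ converges to the Haar state $\int_{\mathbb{KP}}$ if and only if $|g_2|<1$, $|g_3|<1$, $|g_4|<1$ and $|g_{\mathfrak X}|<2$. In this case, the distance to the Haar state decreases exponentially fast from the first step on, i.e. there are constants $C>0$ and $0\le r<1$ such that $\lVert\mathcal F(g)^{\star k}-\int_{\mathbb{KP}}\rVert_{QTV}\le C\,r^k$ for all $k\ge1$.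
   Context: Kac–Paljutkin quantum group $\mathbb{KP}$: $C(\mathbb{KP})=\mathbb C\oplus\mathbb C\oplus\mathbb C\oplus\mathbb C\oplus M_2(\mathbb C)$ as a $*$-algebra, with canonical basis $e_1,e_2,e_3,e_4,E_{11},E_{12},E_{21},E_{22}$. Its Haar state is $\int_{\mathbb{KP}}(x_1\oplus x_2\oplus x_3\oplus x_4\oplus(c_{ij}))=\frac18(x_1+x_2+x_3+x_4+2(c_{11}+c_{22}))$. Its irreducible representations are the one-dimensional $\rho(1)=e_1+e_2+e_3+e_4+E_{11}+E_{22}$ (the unit), $\rho(2)=e_1-e_2-e_3+e_4+E_{11}-E_{22}$, $\rho(3)=e_1-e_2-e_3+e_4-E_{11}+E_{22}$, $\rho(4)=e_1+e_2+e_3+e_4-E_{11}-E_{22}$, and the two-dimensional $\mathfrak X=(\mathfrak X_{ij})_{1\le i,j\le 2}$ with $\mathfrak X_{11}=e_1-e_2+e_3-e_4$, $\mathfrak X_{12}=e^{\imath\pi/4}E_{12}+e^{-\imath\pi/4}E_{21}$, $\mathfrak X_{21}=e^{-\imath\pi/4}E_{12}+e^{\imath\pi/4}E_{21}$, $\mathfrak X_{22}=e_1+e_2-e_3-e_4$, whose character is $\chi(\mathfrak X)=2e_1-2e_4$. These eight coefficients form a linear basis of $C(\mathbb{KP})$, and the coproduct $\Delta$ is the linear map determined by $\Delta(\rho(u))=\rho(u)\otimes\rho(u)$ and $\Delta(\mathfrak X_{ij})=\sum_k\mathfrak X_{ik}\otimes\mathfrak X_{kj}$. For $x\in C(\mathbb{KP})$,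 $\mathcal F(x)$ is the linear functional $y\mapsto\int_{\mathbb{KP}}yx$; convolution of functionals is $\phi\star\psi=(\phi\otimes\psi)\circ\Delta$. The displayed conditions on $g$ are equivalent to $\mathcal F(g)$ being a state (positive unital functional). $\lVert\phi-\psi\rVert_{QTV}=\sup\{|\phi(p)-\psi(p)|:p\in C(\mathbb{KP})\text{ a projection}\}$, and convergence is for this distance. *)

(* Defs.v *)
From HB Require Import structures.
From mathcomp Require Import all_boot all_order all_algebra ring.
From mathcomp Require Import complex.
From mathcomp Require Import boolp classical_sets functions reals ereal.
From mathcomp Require Import topology normedtype sequences trigo.

Set Implicit Arguments.
Unset Strict Implicit.
Unset Printing Implicit Defensive.

Import Order.TTheory GRing.Theory Num.Theory.
Import numFieldNormedType.Exports.

Local Open Scope classical_set_scope.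
Local Open Scope ring_scope.

(* For finite-dimensional V and W, the tensor product V (x) W is realized as
   Hom(V^*, W): the pure tensor of x and y is the map phi |-> phi(x) y. *)
Notation tensor F V W := 'Hom('Hom(V, F^o), W).

Section LinearAlgebra.
Variables (F : fieldType) (V W : vectType F).
Implicit Types (x : V) (y : W) (phi : 'Hom(V, F^o)) (psi : 'Hom(W, F^o)).

Definition tens_fun x y phi : W := phi x *: y.
Fact tens_fun_is_linear x y : linear (tens_fun x y).
Proof.
by move=> a phi psi; rewrite /tens_fun !lfunE /= lfunE scalerDl scalerA.
Qed.
HB.instance Definition _ x y := GRing.isLinear.Build F 'Hom(V, F^o) W *:%R
  (tens_fun x y) (tens_fun_is_linear x y).

Definition tens x y : tensor F V W := linfun (tens_fun x y).

Lemma tensE x y phi : tens x y phi = phi x *: y.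
Proof. exact: lfunE. Qed.

Definition tensf_fun phi psi (t : tensor F V W) : F^o := psi (t phi).
Fact tensf_fun_is_linear phi psi : linear (tensf_fun phi psi).
Proof. by move=> a s t; rewrite /tensf_fun !lfunE /= lfunE /= linearP. Qed.
HB.instance Definition _ phi psi :=
  GRing.isLinear.Build F (tensor F V W) F^o *:%R
    (tensf_fun phi psi) (tensf_fun_is_linear phi psi).

(* The functional phi (x) psi on V (x) W. *)
Definition tensf phi psi : 'Hom(tensor F V W, F^o) :=
  linfun (tensf_fun phi psi).

Lemma tensf_tens phi psi x y : tensf phi psi (tens x y) = phi x * psi y.
Proof. by rewrite lfunE /= /tensf_fun tensE linearZ. Qed.

Variables (n : nat) (b : n.-tuple V) (w : n.-tuple W).

Definition linext_fun x : W := \sum_(u < n) coord b u x *: tnth w u.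
Fact linext_fun_is_linear : linear linext_fun.
Proof.
move=> a x y; rewrite /linext_fun scaler_sumr -big_split /=.
by apply: eq_bigr => u _; rewrite linearP scalerDl scalerA.
Qed.
HB.instance Definition _ :=
  GRing.isLinear.Build F V W *:%R linext_fun linext_fun_is_linear.

(* The linear map sending the basis b to the family w. *)
Definition linext : 'Hom(V, W) := linfun linext_fun.

Lemma linextE u : free b -> linext (tnth b u) = tnth w u.
Proof.
move=> fb; rewrite lfunE /= /linext_fun (bigD1 u) //= big1 => [|v nuv].
  by rewrite (tnth_nth 0) coord_free // eqxx scale1r addr0.
by rewrite (tnth_nth 0 b) coord_free // eq_sym (negPf nuv) scale0r.
Qed.

End LinearAlgebra.

(* The [^o] makes each copy of R[i] a one-dimensional algebra over itself, so
   that the product inherits its algebra and vector space structures. *)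
Definition KP (R : realType) : Type :=
  (R[i]^o * R[i]^o * R[i]^o * R[i]^o * 'M[R[i]]_2)%type.

HB.instance Definition _ (R : realType) := GRing.Algebra.on (KP R).
HB.instance Definition _ (R : realType) := Vector.on (KP R).

Notation functional R := 'Hom(KP R, R[i]^o).

Lemma system (F : numFieldType) (w w' k1 k2 k3 k4 k5 k6 k7 k8 : F) :
  w ^+ 2 - w' ^+ 2 != 0 ->
  k1 + k2 + k3 + k4 + k5 + k8 = 0 -> k1 - k2 - k3 + k4 - k5 + k8 = 0 ->
  k1 - k2 - k3 + k4 + k5 - k8 = 0 -> k1 + k2 + k3 + k4 - k5 - k8 = 0 ->
  k1 + k2 - k3 - k4 = 0 -> k1 - k2 + k3 - k4 = 0 ->
  w * k6 + w' * k7 = 0 -> w' * k6 + w * k7 = 0 ->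
  [/\ k1 = 0, k2 = 0, k3 = 0 & k4 = 0] /\ [/\ k5 = 0, k6 = 0, k7 = 0 & k8 = 0].
Proof.
set s1 := _ + k8; set s2 := _ + k8; set s3 := _ - k8; set s4 := _ - k8.
set s5 := _ - k4; set s6 := _ - k4; set s7 := _ + w' * k7; set s8 := _ + w * k7.
move=> w0 h1 h2 h3 h4 h5 h6 h7 h8.
have -> : k1 = (s1 + s2 + s3 + s4 + 2 * (s5 + s6)) / 8
  by rewrite /s1 /s2 /s3 /s4 /s5 /s6; field.
have -> : k2 = (s1 - s2 - s3 + s4 + 2 * (s5 - s6)) / 8
  by rewrite /s1 /s2 /s3 /s4 /s5 /s6; field.
have -> : k3 = (s1 - s2 - s3 + s4 - 2 * (s5 - s6)) / 8
  by rewrite /s1 /s2 /s3 /s4 /s5 /s6; field.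
have -> : k4 = (s1 + s2 + s3 + s4 - 2 * (s5 + s6)) / 8
  by rewrite /s1 /s2 /s3 /s4 /s5 /s6; field.
have -> : k5 = (s1 - s2 + s3 - s4) / 4 by rewrite /s1 /s2 /s3 /s4; field.
have -> : k8 = (s1 + s2 - s3 - s4) / 4 by rewrite /s1 /s2 /s3 /s4; field.
have -> : k6 = (w * s7 - w' * s8) / (w ^+ 2 - w' ^+ 2)
  by rewrite /s7 /s8; field.
have -> : k7 = (w * s8 - w' * s7) / (w ^+ 2 - w' ^+ 2)
  by rewrite /s7 /s8; field.
by rewrite h1 h2 h3 h4 h5 h6 h7 h8 !(mulr0, addr0, subr0, mul0r).
Qed.

Section KacPaljutkin.
Variable R : realType.
Local Notation C := R[i].
Local Notation A := (KP R).

Implicit Types (x y : A) (phi psi : functional R).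

Definition e1 : A := (1, 0, 0, 0, 0).
Definition e2 : A := (0, 1, 0, 0, 0).
Definition e3 : A := (0, 0, 1, 0, 0).
Definition e4 : A := (0, 0, 0, 1, 0).
Definition E11 : A := (0, 0, 0, 0, delta_mx 0 0).
Definition E12 : A := (0, 0, 0, 0, delta_mx 0 1).
Definition E21 : A := (0, 0, 0, 0, delta_mx 1 0).
Definition E22 : A := (0, 0, 0, 0, delta_mx 1 1).

Definition star x : A :=
  let: (x1, x2, x3, x4, c) := x in
  (Num.conj x1, Num.conj x2, Num.conj x3, Num.conj x4, (map_mx Num.conj c)^T).

Definition projection (p : A) : Prop := star p = p /\ p * p = p.

Definition haar_fun x : C^o :=
  let: (x1, x2, x3, x4, c) := x in
  (x1 + x2 + x3 + x4 + 2 * (c 0 0 + c 1 1)) / 8.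

Fact haar_is_linear : linear haar_fun.
Proof.
have H (F : fieldType) (a x1 x2 x3 x4 x5 x6 y1 y2 y3 y4 y5 y6 : F) :
  (a * x1 + y1 + (a * x2 + y2) + (a * x3 + y3) + (a * x4 + y4) +
   2 * (a * x5 + y5 + (a * x6 + y6))) / 8 =
  a * ((x1 + x2 + x3 + x4 + 2 * (x5 + x6)) / 8) +
  (y1 + y2 + y3 + y4 + 2 * (y5 + y6)) / 8 by ring.
by move=> a [[[[x1 x2] x3] x4] c] [[[[y1 y2] y3] y4] d] /=; rewrite !mxE H.
Qed.
HB.instance Definition _ :=
  GRing.isLinear.Build C A C^o *:%R haar_fun haar_is_linear.

Definition haar : functional R := linfun haar_fun.

Lemma haarE x : haar x = haar_fun x. Proof. exact: lfunE. Qed.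

(* e^{i t} *)
Definition expi (t : R) : C := Complex (cos t) (sin t).

Definition rho1 : A := e1 + e2 + e3 + e4 + E11 + E22.
Definition rho2 : A := e1 - e2 - e3 + e4 + E11 - E22.
Definition rho3 : A := e1 - e2 - e3 + e4 - E11 + E22.
Definition rho4 : A := e1 + e2 + e3 + e4 - E11 - E22.

Definition X11 : A := e1 - e2 + e3 - e4.
Definition X12 : A := expi (pi / 4) *: E12 + expi (- (pi / 4)) *: E21.
Definition X21 : A := expi (- (pi / 4)) *: E12 + expi (pi / 4) *: E21.
Definition X22 : A := e1 + e2 - e3 - e4.

Definition Xrep : 'M[A]_2 := \matrix_(i, j)
  if i == 0 then if j == 0 then X11 else X12
  else if j == 0 then X21 else X22.

Definition chiX : A := \tr Xrep.

Definition coefs : 8.-tuple A :=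
  [tuple rho1; rho2; rho3; rho4; X11; X12; X21; X22].

Definition comult_coefs : 8.-tuple (tensor C A A) :=
  [tuple tens rho1 rho1; tens rho2 rho2; tens rho3 rho3; tens rho4 rho4;
         \sum_k tens (Xrep 0 k) (Xrep k 0); \sum_k tens (Xrep 0 k) (Xrep k 1);
         \sum_k tens (Xrep 1 k) (Xrep k 0); \sum_k tens (Xrep 1 k) (Xrep k 1)].

(* coefs is a basis (kp_basis), hence comult_rho and comult_X. *)
Definition comult := linext coefs comult_coefs.

Definition conv phi psi : functional R := (tensf phi psi \o comult)%VF.

Definition counit_fun x : C^o := x.1.1.1.1.
Fact counit_is_linear : linear counit_fun. Proof. by []. Qed.
HB.instance Definition _ :=
  GRing.isLinear.Build C A C^o *:%R counit_fun counit_is_linear.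

Definition counit : functional R := linfun counit_fun.

(* The k-fold convolution phi * ... * phi; it is the counit for k = 0. *)
Definition convpow phi (k : nat) : functional R := iterop k conv phi counit.

Definition fourier_fun x y : C^o := haar (y * x).
Fact fourier_fun_is_linear x : linear (fourier_fun x).
Proof. by move=> a y z; rewrite /fourier_fun mulrDl -scalerAl linearP. Qed.
HB.instance Definition _ x := GRing.isLinear.Build C A C^o *:%R
  (fourier_fun x) (fourier_fun_is_linear x).

Definition fourier x : functional R := linfun (fourier_fun x).

Lemma fourierE x y : fourier x y = haar (y * x). Proof. exact: lfunE. Qed.

Definition qtv phi psi : \bar R :=
  ereal_sup [set (Normc.normc (phi p - psi p))%:E | p in projection].

Lemma chiXE : chiX = 2 *: e1 - 2 *: e4.
Proof.
rewrite /chiX /mxtrace big_ord_recl big_ord1 !mxE /= /X11 /X22.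
set a := e1; set b := e2; set c := e3; set d := e4.
rewrite !scaler_nat !mulr2n addrACA -opprD; congr (_ - _).
by rewrite -(addrA a b) -(addrA a) addrACA (addrC (- b)) subrKA subrr addr0.
Qed.

Lemma expi_neq : expi (pi / 4 : R) ^+ 2 - expi (- (pi / 4)) ^+ 2 != 0.
Proof.
have p0 := pi_gt0 R.
have p2 : pi / 4 < pi / 2 :> R by rewrite ltr_pM2l // ltf_pV2 ?posrE // ltr_nat.
have s0 : 0 < sin (pi / 4 : R) by rewrite sin_gt0_pihalf ?divr_gt0.
have c0 : 0 < cos (pi / 4 : R).
  by rewrite cos_gt0_pihalf // p2 (@lt_trans _ _ 0) ?oppr_lt0 ?divr_gt0.
rewrite /expi cosN sinN eq_complex /= negb_and; apply/orP; right.
rewrite (_ : _ + _ = 4 * (sin (pi / 4) * cos (pi / 4))); last by ring.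
by rewrite gt_eqF // !mulr_gt0.
Qed.

Lemma kp_free : free coefs.
Proof.
apply/freeP => k; rewrite !big_ord_recl big_ord0 addr0 /=.
rewrite /rho1 /rho2 /rho3 /rho4 /X11 /X12 /X21 /X22.
set w := expi _; set w' := expi _.
set k1 := k _; set k2 := k _; set k3 := k _; set k4 := k _.
set k5 := k _; set k6 := k _; set k7 := k _; set k8 := k _.
move=> H.
suff [[h1 h2 h3 h4] [h5 h6 h7 h8]] :
   [/\ k1 = 0, k2 = 0, k3 = 0 & k4 = 0] /\ [/\ k5 = 0, k6 = 0, k7 = 0 & k8 = 0].
  case=> [[|[|[|[|[|[|[|[|i]]]]]]]] ilt] //;
    [rewrite -[RHS]h1|rewrite -[RHS]h2|rewrite -[RHS]h3|rewrite -[RHS]h4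
    |rewrite -[RHS]h5|rewrite -[RHS]h6|rewrite -[RHS]h7|rewrite -[RHS]h8];
    by congr (k _); apply: val_inj.
apply: (system (w := w) (w' := w')); first exact: expi_neq.
- have := congr1 (fun x : A => x.1.1.1.1) H; rewrite /= /GRing.scale /= => <-; ring.
- have := congr1 (fun x : A => x.1.1.1.2) H; rewrite /= /GRing.scale /= => <-; ring.
- have := congr1 (fun x : A => x.1.1.2) H; rewrite /= /GRing.scale /= => <-; ring.
- have := congr1 (fun x : A => x.1.2) H; rewrite /= /GRing.scale /= => <-; ring.
- have := congr1 (fun x : A => x.2 0 0) H; rewrite /= !mxE /= => <-; ring.
- have := congr1 (fun x : A => x.2 1 1) H; rewrite /= !mxE /= => <-; ring.
- have := congr1 (fun x : A => x.2 0 1) H; rewrite /= !mxE /= => <-; ring.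
- have := congr1 (fun x : A => x.2 1 0) H; rewrite /= !mxE /= => <-; ring.
Qed.
Lemma kp_basis : basis_of fullv coefs.
Proof. by rewrite basisEfree kp_free subvf size_tuple dimvf. Qed.

Lemma comult_rho :
  [/\ comult rho1 = tens rho1 rho1, comult rho2 = tens rho2 rho2,
      comult rho3 = tens rho3 rho3 & comult rho4 = tens rho4 rho4].
Proof.
have H u := linextE comult_coefs u kp_free.
by split; [exact: (H 0)|exact: (H 1)|exact: (H 2)|exact: (H 3)].
Qed.

Lemma comult_X i j :
  comult (Xrep i j) = \sum_k tens (Xrep i k) (Xrep k j).
Proof.
have H u := linextE comult_coefs u kp_free.
have I2 (l : 'I_2) : l = 0 \/ l = 1.
  by case: l => [[|[|l]] lt2] //; [left|right]; apply: val_inj.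
rewrite {1}/Xrep mxE.
case: (I2 i) (I2 j) => -> [] ->.
- exact: (H 4).
- exact: (H 5).
- exact: (H 6).
- exact: (H 7).
Qed.

End KacPaljutkin.

(* Main.v *)
(* The coefficients of the irreducible representations are orthogonal for the
   Haar state, so F(g) takes the value g_u at rho(u) and (gX / 2) delta_ij at
   X_ij. Convolution multiplies these values, hence F(g)^{*k} = F(h_k) for the
   density h_k with coefficients g_u^k and 2 (gX / 2)^k. The distance to the
   Haar state is at most |g_2|^k + |g_3|^k + |g_4|^k + |gX / 2|^k because the
   entries of a projection have modulus at most 1; conversely the projections
   e_1, e_2, E_11, E_22 already recover these four powers, so that a single
   step at distance less than 1/6 forces all four moduli below 1. *)
Require Import Defs.
From mathcomp Require Import all_boot all_order all_algebra.
From mathcomp Require Import complex ring lra.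
From mathcomp Require Import boolp classical_sets functions reals ereal.
From mathcomp Require Import topology normedtype sequences.

Import Order.TTheory GRing.Theory Num.Theory.
Import numFieldNormedType.Exports.

Local Open Scope classical_set_scope.
Local Open Scope ring_scope.

(** * Densities in coordinates, and convolution through values at the matrix coefficients *)

Lemma ord2P (i : 'I_2) : i = 0 \/ i = 1.
Proof. by case: i => [[|[|i]] lti] //; [left|right]; apply: val_inj. Qed.

(* The factor 2 makes x the value of the functional at X_11 and X_22. *)
Definition density {R : realType} (a b c x : R[i]) : KP R :=
  rho1 R + a *: rho2 R + b *: rho3 R + c *: rho4 R + (2 * x) *: chiX R.

Lemma densityE {R : realType} (a b c x : R[i]) :
  let d := density a b c x in
  [/\ d.1.1.1.1 = 1 + a + b + c + 4 * x, d.1.1.1.2 = 1 - a - b + c,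
      d.1.1.2 = 1 - a - b + c & d.1.2 = 1 + a + b + c - 4 * x]
  /\ [/\ d.2 0 0 = 1 + a - b - c, d.2 0 1 = 0, d.2 1 0 = 0
     & d.2 1 1 = 1 - a + b - c].
Proof.
rewrite /density chiXE; split; split;
  rewrite /= ?mxE /= /GRing.scale /=;
  rewrite !(mulr0, mulr1, subr0, sub0r, addr0, add0r, mulrN); ring.
Qed.

(** The matrix block of the density is diagonal, so the trace of the product sees only the diagonal
    entries of [y]. *)
Lemma fourier_density {R : realType} (a b c x : R[i]) (y : KP R) :
  fourier (density a b c x) y =
  (y.1.1.1.1 * (1 + a + b + c + 4 * x) + y.1.1.1.2 * (1 - a - b + c)
   + y.1.1.2 * (1 - a - b + c) + y.1.2 * (1 + a + b + c - 4 * x)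
   + 2 * (y.2 0 0 * (1 + a - b - c) + y.2 1 1 * (1 - a + b - c))) / 8.
Proof.
rewrite fourierE haarE.
have [[]] := densityE a b c x.
case: (density a b c x) => [[[[d1 d2] d3] d4] n] /= <- <- <- <- [<- n01 n10 <-].
case: y => [[[[y1 y2] y3] y4] m].
rewrite /haar_fun /= !mxE !big_ord_recl !big_ord0 /=.
have -> : lift ord0 ord0 = 1 :> 'I_2 by apply: val_inj.
by rewrite n01 n10 !mulr0 !addr0 !add0r.
Qed.

(** The Fourier coefficients of a functional whose block at the two-dimensional representation is
    scalar; scalar blocks make this class stable under convolution. *)
Definition has_coefs {R : realType} (phi : functional R) (a b c x : R[i]) :=
  [/\ phi (rho1 R) = 1, phi (rho2 R) = a, phi (rho3 R) = b & phi (rho4 R) = c]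
  /\ (forall i j, phi (Xrep R i j) = (i == j)%:R * x).

Lemma fourier_density_coefs {R : realType} (a b c x : R[i]) :
  has_coefs (fourier (density a b c x)) a b c x.
Proof.
split; first by split;
  rewrite fourier_density /= !mxE /=;
  rewrite !(mulr1, mul1r, mul0r, subr0, sub0r, addr0, add0r, mulN1r); field.
move=> i j; rewrite fourier_density mxE.
by case: (ord2P i) (ord2P j) => -> [] ->;
  rewrite /= ?mxE /= /GRing.scale /=;
  rewrite !(mulr0, mulr1, mul1r, mul0r, subr0, sub0r, addr0, add0r, mulN1r);
  field.
Qed.

(** The eight matrix coefficients form a basis, and all eight values are prescribed. *)
Lemma has_coefs_inj {R : realType} (phi psi : functional R) (a b c x : R[i]) :
  has_coefs phi a b c x -> has_coefs psi a b c x -> phi = psi.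
Proof.
move=> [[p1 p2 p3 p4] pX] [[q1 q2 q3 q4] qX]; apply/lfunP => y.
rewrite (coord_basis (kp_basis R) (memvf y)) !linear_sum.
apply: eq_bigr => i _; rewrite !linearZ; congr (_ *: _).
have X k l : phi (Xrep R k l) = psi (Xrep R k l) by rewrite pX qX.
have := X 0 0; have := X 0 1; have := X 1 0; have := X 1 1.
rewrite !mxE => h22 h21 h12 h11.
case: i => [[|[|[|[|[|[|[|[|i]]]]]]]] lti]; last by [].
- exact: etrans p1 (esym q1).
- exact: etrans p2 (esym q2).
- exact: etrans p3 (esym q3).
- exact: etrans p4 (esym q4).
- exact: h11.
- exact: h12.
- exact: h21.
- exact: h22.
Qed.

(** The coproduct of a matrix coefficient turns convolution into the product of the blocks, here
    numbers and scalar matrices. *)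
Lemma conv_coefs {R : realType} (phi psi : functional R)
    (a b c x a' b' c' x' : R[i]) :
  has_coefs phi a b c x -> has_coefs psi a' b' c' x' ->
  has_coefs (conv phi psi) (a * a') (b * b') (c * c') (x * x').
Proof.
move=> [[p1 p2 p3 p4] pX] [[q1 q2 q3 q4] qX].
have [d1 d2 d3 d4] := comult_rho R.
have convE y : conv phi psi y = tensf phi psi (comult R y).
  exact: comp_lfunE.
split.
  by split; rewrite convE ?d1 ?d2 ?d3 ?d4 tensf_tens
    ?p1 ?p2 ?p3 ?p4 ?q1 ?q2 ?q3 ?q4 ?mulr1.
move=> i j; rewrite convE comult_X linear_sum /=.
under eq_bigr do rewrite tensf_tens pX qX.
rewrite (bigD1 i) //= big1 => [|k /negPf nki].
  by rewrite eqxx mul1r addr0 mulrCA.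
by rewrite eq_sym nki !mul0r.
Qed.

Lemma convpow_coefs {R : realType} (phi : functional R) (a b c x : R[i])
    (k : nat) :
  has_coefs phi a b c x ->
  has_coefs (convpow phi k.+1) (a ^+ k.+1) (b ^+ k.+1) (c ^+ k.+1) (x ^+ k.+1).
Proof.
move=> h; rewrite /convpow iteropS; elim: k => [|k IHk] //.
by rewrite iterS !(exprS _ k.+1); apply: conv_coefs.
Qed.

Lemma convpow_density {R : realType} (a b c x : R[i]) (k : nat) :
  convpow (fourier (density a b c x)) k.+1 =
  fourier (density (a ^+ k.+1) (b ^+ k.+1) (c ^+ k.+1) (x ^+ k.+1)).
Proof.
apply: has_coefs_inj; first exact/convpow_coefs/fourier_density_coefs.
exact: fourier_density_coefs.
Qed.

(** * Moduli of the entries of a projection *)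

Lemma normc_idem {R : realType} (z : R[i]) : z * z = z -> Normc.normc z <= 1.
Proof.
move=> zz; have /eqP : z * (z - 1) = 0 by rewrite mulrBr mulr1 zz subrr.
rewrite mulf_eq0 subr_eq0 => /orP[] /eqP ->.
  by rewrite Normc.normc0 ler01.
by rewrite Normc.normc1.
Qed.

(** Meant for a diagonal entry [z] of a 2x2 projection, which is the squared norm of its row
    [(z, w)]: then [z] is nonnegative and [z * z <= z]. *)
Lemma norm_le1_sqr {F : numDomainType} (z w : F) :
  z = `|z| ^+ 2 + `|w| ^+ 2 -> `|z| <= 1.
Proof.
move=> zE; have z0 : 0 <= z by rewrite zE addr_ge0 // exprn_ge0.
have [-> | zN0] := eqVneq z 0; first by rewrite normr0 ler01.
have zp : 0 < z by rewrite lt_neqAle eq_sym zN0.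
have : z * z <= z * 1.
  by rewrite mulr1 {3}zE (ger0_norm z0) -expr2 lerDl exprn_ge0.
by rewrite ler_pM2l // ger0_norm.
Qed.

Lemma projection_normc {R : realType} (p : KP R) : projection p ->
  [/\ Normc.normc p.1.1.1.1 <= 1, Normc.normc p.1.1.1.2 <= 1,
      Normc.normc p.1.1.2 <= 1 & Normc.normc p.1.2 <= 1]
  /\ Normc.normc (p.2 0 0) <= 1 /\ Normc.normc (p.2 1 1) <= 1.
Proof.
case: p => [[[[p1 p2] p3] p4] m] [/= sp pp].
have := congr1 (fun x : KP R => x.1.1.1.1) pp.
have := congr1 (fun x : KP R => x.1.1.1.2) pp.
have := congr1 (fun x : KP R => x.1.1.2) pp.
have := congr1 (fun x : KP R => x.1.2) pp.
rewrite /= => i4 i3 i2 i1.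
split; first by split; apply: normc_idem.
have sm i j : Num.conj (m j i) = m i j.
  by have := congr1 (fun x : KP R => x.2 i j) sp; rewrite /= !mxE.
have diag i j : i != j -> Normc.normc (m i i) <= 1.
  move=> nij; rewrite -lecR; apply: (@norm_le1_sqr _ (m i i) (m i j)).
  (* Self-adjointness turns the squared moduli into [m i i * m i i] and [m i j * m j i], which sum
     to the diagonal entry of [m *m m]. *)
  rewrite !normCK !sm.
  have := congr1 (fun x : KP R => x.2 i i) pp; rewrite /= !mxE => {1}<-.
  rewrite (bigD1 i) //= (bigD1 j) 1?eq_sym //= big1 ?addr0 // => k /andP[].
  by case: (ord2P i) (ord2P j) (ord2P k) nij => -> [] -> [] ->.
by split; [apply: (diag 0 1)|apply: (diag 1 0)].
Qed.

(** * The modulus, and the upper bound on the distance *)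

Lemma normc_ge0 {R : realType} (z : R[i]) : 0 <= Normc.normc z.
Proof. by case: z => u v; apply: sqrtr_ge0. Qed.

Lemma normc_triangle {R : realType} (z w : R[i]) :
  Normc.normc (z + w) <= Normc.normc z + Normc.normc w.
Proof. exact: le_normcD. Qed.

Lemma normc_triangleB {R : realType} (z w : R[i]) :
  Normc.normc (z - w) <= Normc.normc z + Normc.normc w.
Proof.
have <- : Normc.normc (- w) = Normc.normc w by apply: normcN.
exact: normc_triangle.
Qed.

Lemma normc_nat {R : realType} (n : nat) : Normc.normc (n%:R : R[i]) = n%:R.
Proof. by rewrite (normcMn (1 : R[i])) Normc.normc1. Qed.

Lemma normc_exp {R : realType} (z : R[i]) k :
  Normc.normc (z ^+ k) = Normc.normc z ^+ k.
Proof.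
by elim: k => [|k IHk]; rewrite ?expr0 ?Normc.normc1 // !exprS Normc.normcM IHk.
Qed.

Lemma normc_lt1 {R : realType} (z : R[i]) : `|z| < 1 <-> Normc.normc z < 1.
Proof. by rewrite -ltcR. Qed.

(** The Haar state has density [rho1], the unit, so subtracting it removes the constant 1 from each
    coordinate of the density. *)
Lemma fourier_density_sub_haar {R : realType} (a b c x : R[i]) (y : KP R) :
  fourier (density a b c x) y - haar R y =
  (y.1.1.1.1 * (a + b + c + 4 * x) + y.1.1.1.2 * (c - a - b)
   + y.1.1.2 * (c - a - b) + y.1.2 * (a + b + c - 4 * x)
   + 2 * (y.2 0 0 * (a - b - c) + y.2 1 1 * (b - a - c))) / 8.
Proof.
rewrite fourier_density haarE; case: y => [[[[y1 y2] y3] y4] m].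
rewrite /haar_fun /= -mulrBl; congr (_ / _).
move: (m 0 0) (m 1 1) => m1 m2.
ring.
Qed.

Lemma normc_div8 {R : realType} (z : R[i]) :
  Normc.normc (z / 8) = Normc.normc z / 8.
Proof. by rewrite Normc.normcM Normc.normcV normc_nat. Qed.

(** Each of [a], [b], [c] occurs up to sign in all six coordinates, with total weight 1+1+1+1+2+2 =
    8, and [x] only at [e1] and [e4], with weight 4+4 = 8; the factor 1/8 makes every constant 1. *)
Lemma qtv_density_le {R : realType} (a b c x : R[i]) :
  (qtv (fourier (density a b c x)) (haar R) <=
   (Normc.normc a + Normc.normc b + Normc.normc c + Normc.normc x)%:E)%E.
Proof.
apply: ge_ereal_sup => _ [p /projection_normc[[]] + + + + [] + +] <-.
rewrite lee_fin fourier_density_sub_haar normc_div8.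
case: p => [[[[p1 p2] p3] p4] m] /= n1 n2 n3 n4 n00 n11.
have M (u v : R[i]) :
    Normc.normc u <= 1 -> Normc.normc (u * v) <= Normc.normc v.
  by move=> u1; rewrite Normc.normcM ler_piMl // normc_ge0.
have x4 : Normc.normc (4 * x) = 4 * Normc.normc x.
  by rewrite Normc.normcM normc_nat.
have s1 := M _ (a + b + c + 4 * x) n1.
have s2 := M _ (c - a - b) n2.
have s3 := M _ (c - a - b) n3.
have s4 := M _ (a + b + c - 4 * x) n4.
have s5 := M _ (a - b - c) n00.
have s6 := M _ (b - a - c) n11.
have t1 := normc_triangle (a + b + c) (4 * x).
have t2 := normc_triangleB (a + b + c) (4 * x).
have t3 := normc_triangle (a + b) c.
have t4 := normc_triangle a b.
have t5 := normc_triangleB (c - a) b.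
have t6 := normc_triangleB c a.
have t7 := normc_triangleB (a - b) c.
have t8 := normc_triangleB a b.
have t9 := normc_triangleB (b - a) c.
have t10 := normc_triangleB b a.
set q := m 0 0 * _ in s5 *; set q' := m 1 1 * _ in s6 *.
set r1 := p1 * _ in s1 *; set r2 := p2 * _ in s2 *.
set r3 := p3 * _ in s3 *; set r4 := p4 * _ in s4 *.
have u0 : Normc.normc (2 * (q + q')) = 2 * Normc.normc (q + q').
  by rewrite Normc.normcM normc_nat.
have u1 := normc_triangle (r1 + r2 + r3 + r4) (2 * (q + q')).
have u2 := normc_triangle (r1 + r2 + r3) r4.
have u3 := normc_triangle (r1 + r2) r3.
have u4 := normc_triangle r1 r2.
have u5 := normc_triangle q q'.
rewrite u0 in u1; rewrite x4 in t1 t2.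
lra.
Qed.

(** * Test projections, and recovering the coefficients from the distance *)

Lemma projection_intro {R : realType} (p1 p2 p3 p4 : R[i]^o)
    (m : 'M[R[i]]_2) :
  Num.conj p1 = p1 -> Num.conj p2 = p2 -> Num.conj p3 = p3 ->
  Num.conj p4 = p4 -> (map_mx Num.conj m)^T = m ->
  p1 * p1 = p1 -> p2 * p2 = p2 -> p3 * p3 = p3 -> p4 * p4 = p4 ->
  m *m m = m -> projection ((p1, p2, p3, p4, m) : KP R).
Proof.
move=> s1 s2 s3 s4 sm i1 i2 i3 i4 im; split.
  by rewrite /star s1 s2 s3 s4 sm.
have -> : ((p1, p2, p3, p4, m) : KP R) * (p1, p2, p3, p4, m) =
    (p1 * p1, p2 * p2, p3 * p3, p4 * p4, m *m m) by [].
by rewrite i1 i2 i3 i4 im.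
Qed.

Lemma projections {R : realType} :
  [/\ projection (e1 R), projection (e2 R),
      projection (E11 R) & projection (E22 R)].
Proof.
have s0 : Num.conj 0 = 0 :> R[i] by apply: conjC0.
have s1 : Num.conj 1 = 1 :> R[i] by apply: conjC1.
have i0 : 0 * 0 = 0 :> R[i]^o by apply: mulr0.
have i1 : 1 * 1 = 1 :> R[i]^o by apply: mulr1.
have sm0 : (map_mx Num.conj (0 : 'M[R[i]]_2))^T = 0.
  by rewrite map_mx0 trmx0.
have im0 : (0 : 'M[R[i]]_2) *m 0 = 0 :> 'M_2 by rewrite mulmx0.
have sm i : (map_mx Num.conj (delta_mx i i : 'M[R[i]]_2))^T = delta_mx i i.
  by rewrite map_delta_mx trmx_delta.
have im i : (delta_mx i i : 'M[R[i]]_2) *m delta_mx i i = delta_mx i i.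
  exact: mul_delta_mx.
by split; apply: projection_intro.
Qed.

Lemma qtv_density_lt {R : realType} (a b c x : R[i]) (e : R) :
  (qtv (fourier (density a b c x)) (haar R) < e%:E)%E ->
  [/\ Normc.normc a < 6 * e, Normc.normc b < 6 * e,
      Normc.normc c < 6 * e & Normc.normc x < 6 * e].
Proof.
move=> qe; have [P1 P2 P11 P22] := @projections R.
have {qe}D p : projection p ->
    Normc.normc (fourier (density a b c x) p - haar R p) < e.
  move=> pp; rewrite -lte_fin; apply: le_lt_trans qe.
  by apply: ereal_sup_ubound; exists p.
have := D _ P22; have := D _ P11; have := D _ P2; have := D _ P1.
rewrite !fourier_density_sub_haar !normc_div8 /= !mxE /=.
rewrite !(mulr0, mulr1, mul1r, mul0r, addr0, add0r).
rewrite !Normc.normcM normc_nat.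
set s1 := a + _ + _ + _; set s2 := c - _ - _.
set s3 := a - _ - _; set s4 := b - _ - _.
(* The tests give moduli below [8 * e] for [s1], [s2] and below [4 * e] for [s3], [s4]. Hence [a]
   and [b] are below [6 * e], [c] is below [4 * e], and [4 * x] is below (8+6+6+4)e = 24e. *)
move=> h1 h2 h3 h4.
have D2 (z u v : R[i]) : 2 * z = - (u + v) ->
    2 * Normc.normc z <= Normc.normc u + Normc.normc v.
  move=> /(congr1 (@Normc.normc R)).
  by rewrite normcN Normc.normcM normc_nat => ->; apply: normc_triangle.
have na := D2 a s2 s4 ltac:(rewrite /s2 /s4; ring).
have nb := D2 b s2 s3 ltac:(rewrite /s2 /s3; ring).
have nc := D2 c s3 s4 ltac:(rewrite /s3 /s4; ring).
have nx : 4 * Normc.normc x <=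
    Normc.normc s1 + Normc.normc a + Normc.normc b + Normc.normc c.
  have -> : 4 * Normc.normc x = Normc.normc (s1 - a - b - c).
    by rewrite -normc_nat -Normc.normcM; congr Normc.normc; rewrite /s1; ring.
  have := normc_triangleB (s1 - a - b) c.
  have := normc_triangleB (s1 - a) b.
  have := normc_triangleB s1 a.
  lra.
(* This sign weakens the bound [4 * e] on [c] to [6 * e]. *)
have e0 : 0 <= e.
  have := normc_ge0 s1.
  lra.
split; lra.
Qed.

Theorem theorem2p1 (R : realType) (g1 g2 g3 g4 gX : R[i]) (g : KP R)
  (hg : g = g1 *: rho1 R + g2 *: rho2 R + g3 *: rho3 R + g4 *: rho4 R
            + gX *: chiX R)
  (h1 : g1 = 1)
  (hplus : 0 <= 1 + g2 + g3 + g4 + 2 * gX)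
  (hminus : 0 <= 1 + g2 + g3 + g4 - 2 * gX)
  (h2 : 0 <= 1 + g2 - g3 - g4)
  (h3 : 0 <= 1 - g2 + g3 - g4)
  (h4 : 0 <= 1 - g2 - g3 + g4) :
  (qtv (convpow (fourier g) k) (haar R) @[k --> \oo] --> 0%E
     <-> [/\ `|g2| < 1, `|g3| < 1, `|g4| < 1 & `|gX| < 2]) /\
  ([/\ `|g2| < 1, `|g3| < 1, `|g4| < 1 & `|gX| < 2] ->
     exists C r : R, [/\ 0 < C, 0 <= r, r < 1 &
       forall k : nat, (1 <= k)%N ->
         (qtv (convpow (fourier g) k) (haar R) <= (C * r ^+ k)%:E)%E]).
Proof.
pose x := gX / 2.
have gE : g = density g2 g3 g4 x.
  by rewrite hg h1 scale1r /density /x mulrCA mulfV ?mulr1 // pnatr_eq0.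
have xP : `|gX| < 2 <-> Normc.normc x < 1.
  rewrite -normc_lt1 /x normrM normfV (ger0_norm (ler0n _ 2)).
  by rewrite ltr_pdivrMr ?mul1r // ltr0n.
(* The exponential bound is the second conclusion and also yields convergence by squeezing. *)
have rate : [/\ `|g2| < 1, `|g3| < 1, `|g4| < 1 & `|gX| < 2] ->
     exists C r : R, [/\ 0 < C, 0 <= r, r < 1 &
       forall k : nat, (1 <= k)%N ->
         (qtv (convpow (fourier g) k) (haar R) <= (C * r ^+ k)%:E)%E].
  move=> [/normc_lt1 l2 /normc_lt1 l3 /normc_lt1 l4 /xP lX].
  pose r := Num.max (Num.max (Normc.normc g2) (Normc.normc g3))
                    (Num.max (Normc.normc g4) (Normc.normc x)).
  (* The constant 4 counts the four powers in the upper bound, each at most that of [r]. *)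
  exists 4, r; split; rewrite ?ltr0n //.
  - by rewrite /r !le_max normc_ge0.
  - by rewrite /r !gt_max l2 l3 l4 lX.
  case=> // k _; rewrite gE convpow_density.
  apply: (le_trans (qtv_density_le _ _ _ _)); rewrite lee_fin !normc_exp.
  have le_pow (z : R[i]) : Normc.normc z <= r ->
      Normc.normc z ^+ k.+1 <= r ^+ k.+1.
    by move=> zr; rewrite lerXn2r ?nnegrE ?(le_trans _ zr) ?normc_ge0.
  have b2 : Normc.normc g2 ^+ k.+1 <= r ^+ k.+1.
    by apply: le_pow; rewrite /r !le_max lexx.
  have b3 : Normc.normc g3 ^+ k.+1 <= r ^+ k.+1.
    by apply: le_pow; rewrite /r !le_max lexx orbT.
  have b4 : Normc.normc g4 ^+ k.+1 <= r ^+ k.+1.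
    by apply: le_pow; rewrite /r !le_max lexx !orbT.
  have bX : Normc.normc x ^+ k.+1 <= r ^+ k.+1.
    by apply: le_pow; rewrite /r !le_max lexx !orbT.
  lra.
split=> //; split=> [cvq|/rate[C [r [C0 r0 r1 qr]]]].
  (* With [e = 6^-1] the bound [6 * e] on the four moduli is exactly 1. *)
  have lt06 : (0%:E < (6^-1 : R)%:E)%E by rewrite lte_fin invr_gt0 ltr0n.
  have := cvq _ (open_ereal_lt' lt06).
  case=> N _ PN.
  (* One time suffices; the successor makes the exponent positive, so a power below 1 forces its
     base below 1. *)
  have : (qtv (convpow (fourier g) N.+1) (haar R) < (6^-1)%:E)%E.
    by apply: PN; apply: leqnSn.
  rewrite gE convpow_density => /qtv_density_lt.
  rewrite divff ?pnatr_eq0 // !normc_exp => -[].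
  rewrite !expr_lt1 ?normc_ge0 // => l2 l3 l4 lX.
  by split; [apply/normc_lt1|apply/normc_lt1|apply/normc_lt1|apply/xP].
apply: (@squeeze_cvge _ _ _ _ (cst 0%E) _ (fun k => (C * r ^+ k)%:E)).
- near=> k; apply/andP; split; last by apply: qr; near: k; exists 1%N.
  (* A supremum in the extended reals is known to be nonnegative only once the set has a nonnegative
     member; [e1] supplies one. *)
  have [P _ _ _] := @projections R.
  apply: le_trans (ereal_sup_ubound _); last by exists (e1 R).
  by rewrite lee_fin normc_ge0.
- exact: cvg_cst.
- by apply: cvg_EFin; [near=> k|apply: cvg_geometric; rewrite ger0_norm].
Unshelve. all: by end_near.
Qed.
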